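(* Let $(X,T)$ be a transitive topological dynamical system such that the relation $\mathbf{RP^2_{s}}(X)$ is the equality relation on $X$. Then $(X,T)$ is distal and minimal.
   Context: A system $(X,T)$ is a compact metrizable space $X$ (with a compatible distance $d$) together with a homeomorphism $T\colon X\to X$. It is transitive if some point has dense orbit $\{T^nx : n\in\mathbb Z\}$, minimal if every point has dense orbit, and distal if $\inf_{n\in\mathbb Z}d(T^nx,T^ny)>0$ for all $x\neq y$ in $X$. $(x,y)\in\mathbf{RP^2_{s}}(X)$ if for every $\epsilon>0$ there exist $x',y'\in X$ and $m,n\in\mathbb Z$ with $d(x',x)<\epsilon$, $d(y',y)<\epsilon$, and $d(T^jx',y)<\epsilon$, $d(T^jy',y)<\epsilon$ for each $j\in\{m,n,m+n\}$. *)

(* Defs.v *)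
From mathcomp Require Import all_boot all_order all_algebra.
From mathcomp Require Import all_classical all_reals all_analysis.

Set Implicit Arguments.
Unset Strict Implicit.
Unset Printing Implicit Defensive.

Import Order.TTheory GRing.Theory Num.Theory.

Local Open Scope classical_set_scope.
Local Open Scope ring_scope.

Record homeo (X : topologicalType) := Homeo {
  homeo_fun :> X -> X;
  homeo_inv : X -> X;
  homeo_funK : cancel homeo_fun homeo_inv;
  homeo_invK : cancel homeo_inv homeo_fun;
  homeo_fun_continuous : continuous homeo_fun;
  homeo_inv_continuous : continuous homeo_inv
}.

(* [Negz k] is -(k + 1), hence the [k.+1] iterations of the inverse. *)
Definition iterz (X : topologicalType) (T : homeo X) (n : int) : X -> X :=
  match n with
  | Posz k => iter k T
  | Negz k => iter k.+1 (homeo_inv T)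
  end.

Definition orbitz (X : topologicalType) (T : homeo X) (x : X) : set X :=
  [set iterz T n x | n in [set: int]].

Definition transitive_system (X : topologicalType) (T : homeo X) : Prop :=
  exists x : X, dense (orbitz T x).

Definition minimal_system (X : topologicalType) (T : homeo X) : Prop :=
  forall x : X, dense (orbitz T x).

(* The set of distances is nonempty and bounded below by 0, so [inf] is its
   genuine greatest lower bound and not the default value 0. *)
Definition distal_system (R : realType) (X : metricType R) (T : homeo X) :
    Prop :=
  forall x y : X, x <> y ->
    0 < inf [set mdist (iterz T n x) (iterz T n y) | n in [set: int]].

Definition RP2s (R : realType) (X : metricType R) (T : homeo X) (x y : X) :
    Prop :=
  forall e : R, 0 < e ->
    exists (x' y' : X) (m n : int),
      [/\ mdist x' x < e,
          mdist y' y < e &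
          forall j : int, j \in [:: m; n; m + n] ->
            mdist (iterz T j x') y < e /\ mdist (iterz T j y') y < e].

(* Main.v *)
(* Let E, the enveloping semigroup, be the closure of {T^n} in X^X for the
   pointwise topology. If u in E is idempotent and z = u w, then u w = u z = z,
   so z is approached simultaneously by T^n w and T^n z; composing two such
   times m and n, the second chosen close enough for T^m, gives m, n and m + n
   as required by RP2s with x' = w and y' = z. Hence w = u w for every w: the
   identity is the only idempotent of E. By Ellis-Numakura, E p contains an
   idempotent for every p in E, so every p in E is left invertible in E.
   Injectivity of the elements of E is distality, by compactness of E; and
   inverting the p in E that maps a transitive point x to y shows that the orbit
   closure E y of y contains x, whence minimality. *)

Require Import Defs.
From mathcomp Require Import all_boot all_order all_algebra.
From mathcomp Require Import all_classical all_reals all_analysis.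
From mathcomp Require Import lra.

Set Implicit Arguments.
Unset Strict Implicit.
Unset Printing Implicit Defensive.

Import Order.TTheory GRing.Theory Num.Theory.
Import numFieldNormedType.Exports.

Local Open Scope classical_set_scope.
Local Open Scope ring_scope.

(** * Idempotents in compact semigroups *)

Lemma compact_chain_bigcap {S : topologicalType} (G : set (set S)) :
  hausdorff_space S -> G !=set0 ->
  (forall B, G B -> compact B /\ B !=set0) -> total_on G subset ->
  \bigcap_(B in G) B !=set0.
Proof.
move=> hS [B0 GB0] GP Gtot.
have filtG : ProperFilter (filter_from G id).
  apply: filter_from_proper => [|B /GP[]//].
  apply: filter_from_filter; first by exists B0.
  move=> B C GB GC; have [BC|CB] := Gtot _ _ GB GC.
    by exists B => // x Bx; split => //; exact: BC.
  by exists C => // x Cx; split => //; exact: CB.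
have [|x [_ clx]] := (GP _ GB0).1 _ filtG; first by exists B0.
exists x => B GB; apply: (compact_closed hS (GP _ GB).1).
by move=> V Vx; apply: clx => //; exists B.
Qed.

(** In a minimal compact nonempty subsemigroup [B] with [p] in [B], the set [B p] is again such a
    subsemigroup, so [B p = B] and some [q] in [B] satisfies [q p = p]. The solutions of [x p = p]
    in [B] then form another one, so they fill [B] and include [p] itself. *)
Lemma ellis_numakura {S : topologicalType} (mul : S -> S -> S) (A : set S) :
  hausdorff_space S -> associative mul ->
  (forall p, continuous (mul^~ p)) ->
  compact A -> A !=set0 -> (forall p q, A p -> A q -> A (mul p q)) ->
  exists2 u, A u & mul u u = u.
Proof.
move=> hS mulA mulc cA A0 AM.
pose semi (B : set S) := [/\ compact B, B !=set0 &
  forall p q, B p -> B q -> B (mul p q)].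
have [C [[cB [p [Ap Cp]] BM] Cmax]] : exists C, semi (A `\` C) /\
    forall D, C `<` D -> ~ semi (A `\` D).
  (* Zorn_bigcup yields maximal sets, hence the passage to complements in A. *)
  apply: (@Zorn_bigcup S (fun C => semi (A `\` C))) => F FP Ftot.
  (* For the empty chain, the intersection of the complements would be the whole space instead of
     [A]. *)
  have [->|/set0P[C0 FC0]] := eqVneq F set0.
    by rewrite bigcup_set0 setD0; split.
  have -> : A `\` \bigcup_(C in F) C = \bigcap_(B in [set A `\` C | C in F]) B.
    apply/seteqP; split => [x [Ax nFx] _ [C FC <-]|x Bx].
      by split=> // Cx; apply: nFx; exists C.
    split=> [|[C FC Cx]]; first by case: (Bx (A `\` C0)) => //; exists C0.
    by case: (Bx (A `\` C)) => //; exists C.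
  split.
  - apply: (subclosed_compact _ cA) => [|x Bx].
      apply: closed_bigI => _ [C FC <-].
      by have [+ _ _] := FP _ FC; exact: compact_closed.
    by case: (Bx (A `\` C0)) => //; exists C0.
  - apply: compact_chain_bigcap => //.
    + by exists (A `\` C0); exists C0.
    + by move=> _ [C FC <-]; have [] := FP _ FC.
    + move=> _ _ [C FC <-] [D FD <-].
      by have [CD|DC] := Ftot _ _ FC FD; [right|left]; exact: setDS.
  - move=> p q Bp Bq _ [C FC <-].
    by have [_ _] := FP _ FC; apply; [apply: Bp|apply: Bq]; exists C.
pose B := A `\` C; rewrite -/B in cB BM.
have Bp : B p by [].
have Bmin D : semi D -> D `<=` B -> B `<=` D.
  move=> semiD DB x Bx; apply: contrapT => Dx.
  (* The complement of [D] contains [C], strictly because of [x], and removing it from [A] leaves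
     [D]. *)
  apply: (Cmax (~` D)).
    split; first by move=> y Cy /DB[_].
    by move/(_ x Dx); case: Bx.
  by rewrite setDE setCK (_ : A `&` D = D)//; apply/setIidPr => y /DB[].
have pBp : B `<=` (mul^~ p) @` B.
  apply: Bmin.
  - split.
    + by apply: continuous_compact => //; exact: continuous_subspaceT.
    + by exists (mul p p); exists p.
    + move=> _ _ [x Bx <-] [y By <-]; exists (mul (mul x p) y).
        exact: (BM _ _ (BM _ _ Bx Bp) By).
      by rewrite !mulA.
  - by move=> _ [x Bx <-]; exact: BM.
have [q Bq qp] := pBp _ Bp.
have Bfix : B `<=` B `&` (mul^~ p) @^-1` [set p].
  apply: Bmin.
  - split.
    + apply: (subclosed_compact _ cB) => [|? []//].
      apply: closedI; first exact: compact_closed.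
      apply: preimage_closed; first by move=> x _; exact: mulc.
      exact: (accessible_closed_set1 (hausdorff_accessible hS)).
    + by exists q.
    + move=> x y [Bx xp] [By yp]; split; first exact: BM.
      by rewrite /= -mulA yp.
  - by move=> x [].
by have [_ pp] := Bfix _ Bp; exists p.
Qed.

(** * Continuity into the pointwise topology *)

Lemma ptws_continuous {Y Z : topologicalType} {I : Type}
    (f : Y -> {ptws I -> Z}) :
  (forall i, continuous (fun y => f y i)) -> continuous f.
Proof.
move=> fc y; apply/cvg_sup => i.
apply: (@continuous_comp_initial _ _ _ (fun g : I -> Z => g i) f).
exact: fc.
Qed.

Lemma closure_subset_preimage {Y Z : topologicalType} (f : Y -> Z)
    (A : set Y) (B : set Z) :
  continuous f -> closed B -> A `<=` f @^-1` B -> closure A `<=` f @^-1` B.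
Proof.
move=> fc Bcl /closureS AB x /AB.
by apply: preimage_closed Bcl _ => z _; exact: fc.
Qed.

(** * Integer iterates and continuity of the distance *)

Section iterz.
Context {X : topologicalType} (T : homeo X).

Lemma iterz_continuous n : continuous (iterz T n).
Proof.
suff H (f : X -> X) k : continuous f -> continuous (iter k f).
  case: n => k; apply: H; first exact: homeo_fun_continuous.
  exact: homeo_inv_continuous.
move=> fc; elim: k => [|k IH] x /=; first exact: cvg_id.
exact: (continuous_comp (IH x) (fc _)).
Qed.

Lemma iterzS n x : iterz T (n + 1) x = T (iterz T n x).
Proof.
(* [Negz 0 + 1] leaves the negative branch, so it is split from [Negz k.+1]. *)
case: n => [k|[|k]]; first by rewrite -PoszD addn1.
  by rewrite /= homeo_invK.
have -> : Negz k.+1 + 1 = Negz k by rewrite !NegzE -addn1 PoszD opprD addrNK.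
by rewrite /= homeo_invK.
Qed.

Lemma iterzD m n x : iterz T (m + n) x = iterz T m (iterz T n x).
Proof.
elim/int_rect: m => [|k IH|k IH]; first by rewrite add0r.
  by rewrite -addn1 PoszD addrAC !iterzS IH.
(* Applying the injective [T] to both sides turns the downward step into an upward one. *)
apply: (can_inj (homeo_funK T)); rewrite -!iterzS.
by rewrite addrAC -addn1 PoszD opprD addrNK IH.
Qed.

End iterz.

Lemma mdist_continuous {R : realType} {X : metricType R} {Y : topologicalType}
    (f g : Y -> X) :
  continuous f -> continuous g -> continuous (fun t => mdist (f t) (g t)).
Proof.
move=> fc gc t; apply/cvgrPdist_lt => e e0.
have e20 : 0 < e / 2 by rewrite divr_gt0.
have fe := metricType_numDomainType.cvgr_dist_lt (fc t) e20.
have ge := metricType_numDomainType.cvgr_dist_lt (gc t) e20.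
apply: filterS2 (fe _) (ge _) => s fs gs.
have := metric_triangle (f t) (f s) (g t).
have := metric_triangle (f s) (g s) (g t).
have := metric_triangle (f s) (f t) (g s).
have := metric_triangle (f t) (g t) (g s).
rewrite (metric_sym (f s) (f t)) (metric_sym (g s) (g t)).
move: fs gs; rewrite ltr_norml; lra.
Qed.

(** * The enveloping semigroup *)

Section enveloping_semigroup.
Context {R : realType} {X : metricType R} (T : homeo X).

Definition enveloping : set {ptws X -> X} :=
  closure (range (iterz T : int -> {ptws X -> X})).

Lemma eval_continuous (x : X) : continuous (fun p : {ptws X -> X} => p x).
Proof. exact: (@proj_continuous X (fun=> X)). Qed.

Lemma precomp_continuous (q : X -> X) :
  continuous (fun p : {ptws X -> X} => (p \o q : {ptws X -> X})).
Proof. by apply: ptws_continuous => x; exact: eval_continuous. Qed.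

Lemma iterz_enveloping n : enveloping (iterz T n).
Proof. by apply: subset_closure; exists n. Qed.

(** Composition is continuous in its left factor, but in its right factor only when the left one is
    a continuous map. Hence two passes to the closure: first over [q] with an iterate on the left,
    then over [p] with [q] fixed. *)
Lemma enveloping_comp p q : enveloping p -> enveloping q -> enveloping (p \o q).
Proof.
move=> Ep Eq.
have postc n :
    continuous (fun r : {ptws X -> X} => (iterz T n \o r : {ptws X -> X})).
  apply: ptws_continuous => x r.
  exact: (continuous_comp (@eval_continuous x r) (@iterz_continuous _ T n _)).
have iterzq n : enveloping (iterz T n \o q).
  have sub : range (iterz T : int -> {ptws X -> X}) `<=`
      (fun r : {ptws X -> X} => (iterz T n \o r : {ptws X -> X})) @^-1`
        enveloping.
    move=> _ [m _ <-]; rewrite /preimage /=.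
    rewrite (_ : _ \o _ = iterz T (n + m)); first exact: iterz_enveloping.
    by apply/funext => x; rewrite iterzD.
  exact: (closure_subset_preimage (postc n) (@closed_closure _ _) sub).
have sub : range (iterz T : int -> {ptws X -> X}) `<=`
    (fun r : {ptws X -> X} => (r \o q : {ptws X -> X})) @^-1` enveloping.
  by move=> _ [n _ <-]; exact: iterzq.
exact (closure_subset_preimage (@precomp_continuous q) (@closed_closure _ _) sub
  Ep).
Qed.

Lemma enveloping_approx p a b U V : enveloping p ->
  nbhs (p a) U -> nbhs (p b) V ->
  exists n, U (iterz T n a) /\ V (iterz T n b).
Proof.
move=> Ep Ua Vb.
have [] := Ep ((fun r => r a) @^-1` U `&` (fun r => r b) @^-1` V).
  apply: filterI; first exact: (@eval_continuous a p).
  exact: (@eval_continuous b p).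
by move=> _ [[n _ <-] ?]; exists n.
Qed.

Lemma RP2s_enveloping_idempotent u w :
  enveloping u -> u \o u = u -> RP2s T w (u w).
Proof.
move=> Eu uu e e0; set z := u w.
have uz : u z = z by rewrite /z -[in RHS]uu.
have near_ball (v : X) d : 0 < d -> \forall t \near v, mdist t v < d.
  move=> d0; apply/metricType_numDomainType.nbhs_mdistP; exists d => // t /=.
  by rewrite metric_sym.
have ez : nbhs z [set t | mdist t z < e] by exact: near_ball.
have [m [mw mz]] : exists m, mdist (iterz T m w) z < e /\
    mdist (iterz T m z) z < e.
  pose U := [set t | mdist t z < e].
  by apply: (enveloping_approx (p := u) (U := U) (V := U)) => //; rewrite uz.
(* With [m] fixed, the slack [e - mdist (iterz T m z) z] and continuity give a whole neighbourhood
   of [z] that the [m]-th iterate sends within [e] of [z]; [n] is then chosen to bring both [w] and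
   [z] into it. *)
have mzn : \forall t \near z, mdist (iterz T m t) z < e.
  have Vm : nbhs (iterz T m z) [set t | mdist t z < e].
    rewrite -subr_gt0 in mz.
    apply: filterS (near_ball (iterz T m z) _ mz) => t /=.
    by rewrite ltrBrDr; apply: le_lt_trans; exact: metric_triangle.
  exact: (@iterz_continuous _ T m z _ Vm).
have [n [[nw mnw] [nz mnz]]] : exists n,
    (mdist (iterz T n w) z < e /\ mdist (iterz T m (iterz T n w)) z < e) /\
    (mdist (iterz T n z) z < e /\ mdist (iterz T m (iterz T n z)) z < e).
  apply: (enveloping_approx (p := u)
    (U := [set t | mdist t z < e /\ mdist (iterz T m t) z < e])
    (V := [set t | mdist t z < e /\ mdist (iterz T m t) z < e])) => //.
    exact: filterI.
  by rewrite uz; exact: filterI.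
exists w, z, m, n; split; rewrite ?mdistxx // => j.
rewrite !inE => /or3P[] /eqP ->; split => //.
  by rewrite iterzD.
by rewrite iterzD.
Qed.

Context (compactX : compact [set: X]).

Let compact_ptws : compact [set: {ptws X -> X}].
Proof.
rewrite (_ : setT = [set f : {ptws X -> X} | forall i, [set: X] (f i)]).
  exact: (@tychonoff X (fun=> X) (fun=> setT)).
by apply/seteqP; split.
Qed.

Let hausdorff_ptws : hausdorff_space {ptws X -> X}.
Proof.
by apply: (@hausdorff_product X (fun=> X)) => _; exact: metric_hausdorff.
Qed.

Lemma compact_enveloping : compact enveloping.
Proof. exact: subclosed_compact (@closed_closure _ _) compact_ptws _. Qed.

Lemma enveloping_idempotent (A : set {ptws X -> X}) :
  closed A -> A `<=` enveloping -> A !=set0 ->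
  (forall p q, A p -> A q -> A (p \o q)) ->
  exists2 u, A u & u \o u = u.
Proof.
move=> clA AE A0 AM.
apply: (@ellis_numakura {ptws X -> X} (fun p q => p \o q)) => //.
- by move=> q; exact: precomp_continuous.
- exact: subclosed_compact clA compact_enveloping AE.
Qed.

(** The image of [enveloping] under evaluation at [x] is compact, hence closed, and it contains the
    dense orbit of [x]. *)
Lemma enveloping_transitive x y : dense (orbitz T x) ->
  exists2 p, enveloping p & p x = y.
Proof.
move=> dx.
have cEx : closed [set p x | p in enveloping].
  apply: compact_closed; first exact: metric_hausdorff.
  apply: continuous_compact compact_enveloping.
  by apply: continuous_subspaceT; exact: eval_continuous.
suff [p Ep px] : [set p x | p in enveloping] y by exists p.
apply: cEx => B /nbhs_interior By.
have [|_ [/[swap] -[n _ <-] Bn]] := dx B^° _ (open_interior _).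
  by exists y; exact: nbhs_singleton.
exists (iterz T n x); split; last exact: interior_subset Bn.
by exists (iterz T n) => //; exact: iterz_enveloping.
Qed.

(** * Consequences of the triviality of [RP2s] *)

Context (RP2s_eq : forall x y, RP2s T x y -> x = y).

Lemma enveloping_idempotent_id u : enveloping u -> u \o u = u -> u = id.
Proof.
move=> Eu uu; apply/funext => x.
by apply/esym/RP2s_eq/RP2s_enveloping_idempotent.
Qed.

Lemma enveloping_linv p : enveloping p -> exists2 q, enveloping q & q \o p = id.
Proof.
move=> Ep.
have [] := @enveloping_idempotent [set q \o p | q in enveloping].
- apply: compact_closed; first exact: hausdorff_ptws.
  apply: continuous_compact compact_enveloping.
  by apply: continuous_subspaceT; exact: precomp_continuous.
- by move=> _ [q Eq <-]; exact: enveloping_comp.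
- by exists (p \o p); exists p.
- move=> _ _ [q Eq <-] [r Er <-]; exists (q \o p \o r) => //.
  by apply: enveloping_comp => //; exact: enveloping_comp.
move=> _ [q Eq <-] qp; exists q => //.
by apply: enveloping_idempotent_id => //; exact: enveloping_comp.
Qed.

Lemma enveloping_inj p : enveloping p -> injective p.
Proof.
move=> /enveloping_linv[q _ qp]; apply: (can_inj (g := q)) => x.
by rewrite -[LHS]/((q \o p) x) qp.
Qed.

End enveloping_semigroup.

Theorem proposition3 (R : realType) (X : metricType R) (T : homeo X)
    (compactX : compact [set: X])
    (transT : transitive_system T)
    (RP2s_eq : forall x y : X, RP2s T x y <-> x = y) :
  distal_system T /\ minimal_system T.
Proof.
have RP2s_id x y : RP2s T x y -> x = y by move/RP2s_eq.
split=> [x y xy|y O [z Oz] openO].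
  have distc : continuous (fun p : {ptws X -> X} => mdist (p x) (p y)).
    by apply: mdist_continuous; exact: eval_continuous.
  (* The distance between the images of [x] and [y] attains its minimum over [enveloping] at some
     [c]. Injectivity of [c] makes that minimum positive, and it bounds the distances along all
     iterates from below. *)
  have [|c /set_mem Ec cmin] := compact_EVT_min _
    (@compact_enveloping _ _ T compactX) (continuous_subspaceT distc).
    by exists (iterz T 0); exact: iterz_enveloping.
  apply: (@lt_le_trans _ _ (mdist (c x) (c y))).
    by rewrite mdist_gt0; apply/eqP => /(enveloping_inj compactX RP2s_id Ec).
  apply: lb_le_inf.
    by exists (mdist (iterz T 0 x) (iterz T 0 y)); exists 0.
  move=> _ [n _ <-]; apply: cmin; apply/mem_set; exact: iterz_enveloping.
have [x0 dx0] := transT.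
have [p Ep py] := enveloping_transitive compactX y dx0.
have [q Eq qp] := enveloping_linv compactX RP2s_id Ep.
have [r Er rz] := enveloping_transitive compactX z dx0.
(* Since [q] undoes [p] at [x0], the map [r \o q] sends [y] to [r x0 = z], a point of [O]. Only one
   point has to be followed, so the second neighbourhood is the whole space. *)
have [n [On _]] : exists n, O (iterz T n y) /\ setT (iterz T n y).
  apply: (enveloping_approx (p := r \o q)); first exact: enveloping_comp.
    rewrite -py -[(r \o q) (p x0)]/(r ((q \o p) x0)) qp rz.
    exact: open_nbhs_nbhs.
  exact: filterT.
by exists (iterz T n y); split => //; exists n.
Qed.
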